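(* Let $\mathbf a=(a_n)_{n=0}^\infty$ be a bracket word. Then there exists a constant $C>0$ such that $p_{\mathbf a}(N)=O(N^C)$ for all $N\in\mathbb N$; the implied constant may depend on $\mathbf a$.
   Context: $\mathbb N=\{1,2,\dots\}$ and $\mathbb N_0=\mathbb N\cup\{0\}$. Generalised polynomial (GP) maps $\mathbb R\to\mathbb R$ form the smallest family of maps that contains all polynomial maps $\mathbb R\to\mathbb R$, is closed under sums and products, and contains $\lfloor g\rfloor$ (the map $x\mapsto\lfloor g(x)\rfloor$) whenever it contains $g$. A GP map $\mathbb N_0\to\mathbb R$ is the restriction to $\mathbb N_0$ of a GP map $\mathbb R\to\mathbb R$. A bracket word over a finite alphabet $\Sigma$ is an infinite word $\mathbf a=(a_n)_{n=0}^\infty\in\Sigma^\infty$ of the form $a_n=c(g(n))$ for all $n\in\mathbb N_0$, where $g\colon\mathbb N_0\to\mathbb R$ is a GP map taking only finitely many values and $c\colon g(\mathbb N_0)\to\Sigma$ is an arbitrary map. The subword complexity of $\mathbf a$ is $p_{\mathbf a}(N)=|\{a_na_{n+1}\cdots a_{n+N-1} : n\in\mathbb N_0\}|$, the number of distinct length-$N$ subwords (blocks of consecutive letters) appearing in $\mathbf a$. *)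

(* Defs.v *)
From mathcomp Require Import all_boot all_order all_algebra.
From mathcomp Require Import all_classical all_reals all_analysis.

Set Implicit Arguments.
Unset Strict Implicit.
Unset Printing Implicit Defensive.

Import Order.TTheory GRing.Theory Num.Theory.

Local Open Scope classical_set_scope.
Local Open Scope ring_scope.

Inductive GP_real (R : realType) : (R -> R) -> Prop :=
| GP_poly (p : {poly R}) : GP_real (fun x => p.[x])
| GP_add (f g : R -> R) :
    GP_real f -> GP_real g -> GP_real (fun x => f x + g x)
| GP_mul (f g : R -> R) :
    GP_real f -> GP_real g -> GP_real (fun x => f x * g x)
| GP_floor (g : R -> R) :
    GP_real g -> GP_real (fun x => (Num.floor (g x))%:~R).

Definition GP_nat (R : realType) (g : nat -> R) : Prop :=
  exists2 G : R -> R, GP_real G & forall n : nat, g n = G n%:R.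

(* Since [g n] always lies in the range of [g] and [Sigma] is inhabited by
   [a 0], a map from the range of [g] to [Sigma] amounts to the restriction of
   a total map [c : R -> Sigma]; values of [c] off the range are irrelevant. *)
Definition bracket_word (R : realType) (Sigma : finType) (a : nat -> Sigma)
    : Prop :=
  exists g : nat -> R,
    [/\ GP_nat g, finite_set (range g) &
        exists c : R -> Sigma, forall n : nat, a n = c (g n)].

Definition subword (Sigma : Type) (a : nat -> Sigma) (n N : nat) :
    N.-tuple Sigma :=
  [tuple a (n + i)%N | i < N].

Definition subword_complexity (Sigma : finType) (a : nat -> Sigma) (N : nat)
    : nat :=
  #|[set w : N.-tuple Sigma | `[< exists n : nat, w = subword a n N >]]%SET|.

(* Main.v *)
Require Import Defs.
From mathcomp Require Import all_boot all_order all_algebra.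
From mathcomp Require Import all_classical all_reals all_analysis.
From mathcomp Require Import zify ring lra.

(** A generalised polynomial f is written, on each window x, x+1, ..., x+N-1,
    as f (x + i) = sum_j c_j w_j(i): the number of terms is independent of N,
    the real coefficients c_j depend on x without any control, and the
    integer-valued functions w_j are bounded by a power of N and range over
    only polynomially many (in N) possibilities as x varies (few_windows).
    For a polynomial one takes w_j(i) = i^j, and sums and products are
    immediate.  For a floor, splitting each c_j into integer and fractional
    parts t_j gives
      floor (sum_j c_j w_j) = sum_j floor(c_j) w_j + floor (sum_j t_j w_j),
    so a single new function of i appears.  It is determined by the answers to
    the polynomially many questions m <= sum_j t_j w_j(i), with i < N and m an
    integer of polynomial size; each question is an affine half-space in the
    space of the parameters t, whose dimension is fixed, and M hyperplanes cut
    a space of dimension d into only O(M^d) cells (sign_patterns,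
    threshold_patterns).  Hence few_windows is stable under floor.

    The final count uses the same fact: if g has finite range V, then for given
    functions w_j the word read in the window is determined by the answers to
    the questions v <= sum_j c_j w_j(i) with i < N and v in V, that is, by the
    cell of c in an arrangement of N |V| hyperplanes.

    Everything is uniform over real starting points x, so no equidistribution
    is involved. *)

Set Implicit Arguments.
Unset Strict Implicit.
Unset Printing Implicit Defensive.

Import Order.TTheory GRing.Theory Num.Theory.

Local Open Scope ring_scope.

(** * Cells of a hyperplane arrangement *)

Lemma leq_exp_bound m n a b :
  (m <= n)%N -> (0 < n)%N -> (a <= b)%N -> (m ^ a <= n ^ b)%N.
Proof.
move=> le_mn n_gt0 le_ab; apply: (@leq_trans (n ^ a)).
  by case: a {le_ab} => // a; rewrite leq_exp2r.
by rewrite leq_pexp2l.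
Qed.

(** Induction on the number of forms.  Adding a form l splits a pattern of the
    previous forms into two only if that pattern occurs on both sides of l.
    Cells being convex, the pattern then also occurs on the hyperplane l = 0 of
    U, where the induction hypothesis applies with a smaller rank.  A covering
    list (instead of the exact set of patterns) is enough and spares any
    discussion of which patterns occur. *)
Lemma sign_patterns (R : realFieldType) n (ls : seq 'cV[R]_n) (U : 'M[R]_n) :
  exists2 s : seq bitseq, (size s <= (size ls).+1 ^ \rank U)%N &
    forall x : 'rV_n, (x <= U)%MS ->
      [seq 0 <= (x *m l) 0 0 | l <- ls] \in s.
Proof.
elim: ls U => [|l ls IH] U.
  by exists [:: [::]] => [|x _]; rewrite ?exp1n ?mem_head.
have [s size_s cover_s] := IH U.
case: (eqVneq (U *m l) 0) => [Ul0 | Ul_neq0].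
  exists [seq true :: b | b <- s] => [|x xU] /=.
    by rewrite size_map (leq_trans size_s)// leq_exp_bound.
  have -> : (x *m l) 0 0 = 0.
    by have /submxP[y ->] := xU; rewrite -mulmxA Ul0 mulmx0 mxE.
  by rewrite lexx map_f// cover_s.
have [s' size_s' cover_s'] := IH (U :&: kermx l)%MS.
have rank_lt : (\rank (U :&: kermx l)%MS < \rank U)%N.
  rewrite rank_ltmx// ltmxE capmxSl/= sub_capmx submx_refl/=.
  by apply/sub_kermxP/eqP.
(* Each old pattern b is extended by up b, true as soon as b occurs on the
   side 0 <= l; the extensions by false that are missed this way come from
   patterns occurring on both sides. *)
pose pat (x : 'rV[R]_n) := [seq 0 <= (x *m k) 0 0 | k <- ls].
pose up b := `[< exists x : 'rV[R]_n,
  [/\ (x <= U)%MS, pat x = b & 0 <= (x *m l) 0 0] >].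
exists ([seq up b :: b | b <- s] ++ [seq false :: b | b <- s']) => [|x xU] /=.
  rewrite size_cat !size_map.
  move: size_s size_s' rank_lt; set m := size ls; case: (\rank U) => // r.
  move=> size_s size_s' rank_lt; apply: (leq_trans (leq_add size_s size_s')).
  apply: (@leq_trans (m.+1 ^ r.+1 + m.+1 ^ r)).
    by rewrite leq_add2l leq_exp_bound.
  rewrite expnS -[X in (_ + X <= _)%N]mul1n -mulnDl addn1 expnS leq_mul2l/=.
  by rewrite leq_exp_bound.
rewrite mem_cat -/(pat x).
case: (lerP 0 ((x *m l) 0 0)) => [lx_ge0|lx_lt0].
  have up_x : up (pat x) by apply/asboolP; exists x.
  by apply/orP; left; rewrite -{1}up_x (map_f (fun b => up b :: b))// cover_s.
case: (boolP (up (pat x))) => [|/negbTE up_x]; last first.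
  by apply/orP; left; rewrite -{1}up_x (map_f (fun b => up b :: b))// cover_s.
move=> /asboolP[y [yU pat_y ly_ge0]]; apply/orP; right; apply: map_f.
(* A positive multiple of the point where the segment from x to y crosses the
   hyperplane l = 0. *)
pose z := (y *m l) 0 0 *: x - (x *m l) 0 0 *: y.
have zE (k : 'cV[R]_n) : (z *m k) 0 0 =
    (y *m l) 0 0 * (x *m k) 0 0 - (x *m l) 0 0 * (y *m k) 0 0.
  by rewrite mulmxBl -!scalemxAl !mxE.
have zU : (z <= U :&: kermx l)%MS.
  rewrite sub_capmx addmx_sub ?eqmx_opp ?scalemx_sub//=.
  apply/sub_kermxP/matrixP => i j; rewrite !ord1 zE !mxE; ring.
rewrite (_ : pat x = pat z) ?cover_s'//.
apply/eq_in_map => k k_ls.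
have /eqP : (0 <= (y *m k) 0 0) = (0 <= (x *m k) 0 0).
  by move/eq_in_map: pat_y; apply.
rewrite zE; case: (lerP 0 ((x *m k) 0 0)) => [kx|kx] /eqP ky; apply/esym.
  by apply/idP; nra.
by apply/negbTE; rewrite -ltNge; move/negbT: ky; rewrite -ltNge; nra.
Qed.

(** The affine case follows from the linear one by adding a coordinate which is
    set to 1 and carries the thresholds; hence the exponent #|J|.+1. *)
Lemma threshold_patterns (R : realFieldType) (I J : finType)
    (A : I -> J -> R) (b : I -> R) :
  exists pat : 'I_(#|I|.+1 ^ #|J|.+1) -> I -> bool,
    forall c : J -> R, exists e, forall i,
      pat e i = (b i <= \sum_j c j * A i j).
Proof.
pose form i : 'cV[R]_(#|J|.+1) :=
  \col_k (if unlift ord0 k is Some j then A i (enum_val j) else - b i).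
have [s size_s cover_s] := sign_patterns [seq form i | i <- enum I] 1%:M.
rewrite size_map -cardE mxrank1 in size_s.
exists (fun e i => nth false (nth [::] s e) (enum_rank i)) => c.
pose x : 'rV[R]_(#|J|.+1) :=
  \row_k (if unlift ord0 k is Some j then c (enum_val j) else 1).
have xE i : (x *m form i) 0 0 = \sum_j c j * A i j - b i.
  rewrite mxE big_ord_recl !mxE unlift_none mul1r addrC; congr (_ - _).
  rewrite (reindex (@enum_val J predT)) /=; last first.
    by apply: onW_bij; apply: enum_val_bij.
  by apply: eq_bigr => j _; rewrite !mxE liftK.
have xs := cover_s x (submx1 x).
have lt_e : (index [seq 0 <= (x *m l) 0 0 | l <- [seq form i | i <- enum I]]%R s
    < #|I|.+1 ^ #|J|.+1)%N.
  by apply: leq_trans size_s; rewrite index_mem.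
exists (Ordinal lt_e) => i; rewrite nth_index// -map_comp.
rewrite (nth_map i) ?nth_enum_rank ?size_enum_ord; last by rewrite -cardE.
by rewrite /= xE subr_ge0.
Qed.

(** * Floors of integer combinations with coefficients in [0, 1] *)

Lemma absz_floor_le (R : realType) (M : nat) (y : R) :
  `|y| <= M%:R -> (`|Num.floor y| <= M)%N.
Proof.
rewrite ler_norml => /andP[lo hi].
have : - (M%:Z) <= Num.floor y by rewrite floor_ge_int mulrNz.
have : Num.floor y < M%:Z + 1.
  by rewrite floor_lt_int intrD (le_lt_trans hi)// ltrDl.
lia.
Qed.

Lemma norm_weighted_sum (R : realType) (J : finType) (B : nat)
    (t : J -> R) (w : J -> int) :
  (forall j, 0 <= t j <= 1) -> (forall j, (`|w j| <= B)%N) ->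
  `|\sum_j t j * (w j)%:~R| <= (#|J| * B)%:R.
Proof.
move=> t01 w_le; apply: le_trans (ler_norm_sum _ _ _) _.
rewrite natrM mulr_natl -sumr_const; apply: ler_sum => j _.
have /andP[t_ge0 t_le1] := t01 j.
rewrite normrM (ger0_norm t_ge0) -intr_norm -abszE -pmulrn.
apply: le_trans (ler_wpM2r _ t_le1) _; first exact: ler0n.
by rewrite mul1r ler_nat.
Qed.

(** The sums have absolute value at most M = #|J| * B, so their floors are
    determined by the comparisons with the 2M+1 integers between -M and M; the
    bound then comes from the threshold patterns of the N * (2M+1) pairs (i, m).
    Every F e is itself the floor of such a sum, so that it obeys the bound M
    and can serve as a new function w_j. *)
Lemma floor_patterns (R : realType) (J : finType) (N B : nat)
    (w : J -> 'I_N -> int) :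
  (forall j i, (`|w j i| <= B)%N) ->
  exists F : 'I_((N * (2 * (#|J| * B)).+1).+1 ^ #|J|.+1) -> 'I_N -> int,
    (forall e i, (`|F e i| <= #|J| * B)%N) /\
    forall t : J -> R, (forall j, 0 <= t j <= 1) ->
      exists e, forall i, F e i = Num.floor (\sum_j t j * (w j i)%:~R).
Proof.
move=> w_le; set M := (#|J| * B)%N.
pose I := ('I_N * 'I_(2 * M).+1)%type.
have cardI : #|{: I}| = (N * (2 * M).+1)%N by rewrite card_prod !card_ord.
have := @threshold_patterns R I J (fun u j => (w j u.1)%:~R)
  (fun u => (u.2%:Z - M%:Z)%:~R).
rewrite cardI => -[pat patP].
pose S (t : J -> R) i := \sum_j t j * (w j i)%:~R.
pose codes e (t : J -> R) := (forall j, 0 <= t j <= 1) /\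
  forall u : I, pat e u = ((u.2%:Z - M%:Z)%:~R <= S t u.1).
have same e t t' i : codes e t -> codes e t' ->
    Num.floor (S t i) <= Num.floor (S t' i).
  move=> [t01 et] [t'01 et'].
  have := absz_floor_le (norm_weighted_sum t01 (w_le^~ i)).
  rewrite -/(S t i) -/M => fl_le.
  have lt_m : (absz (Num.floor (S t i) + M%:Z)%R < (2 * M).+1)%N by lia.
  have := et' (i, Ordinal lt_m); rewrite et /=.
  have -> : (absz (Num.floor (S t i) + M%:Z))%:Z - M%:Z = Num.floor (S t i).
    lia.
  by rewrite floor_le floor_ge_int => <-.
(* A pattern that no admissible t realises is represented by t = 0, which is
   admissible. *)
have rep e : exists t, (forall j, 0 <= t j <= 1) /\
    forall t', codes e t' -> codes e t.
  case: (pselect (exists t', codes e t')) => [[t et]|no_t].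
    by exists t; split=> //; case: et.
  exists (fun=> 0); split=> [j|t' et']; first by rewrite lexx ler01.
  by case: no_t; exists t'.
have [r rP] := choice rep.
exists (fun e i => Num.floor (S (r e) i)); split=> [e i|t t01].
  by apply: absz_floor_le; apply: norm_weighted_sum => //; case: (rP e).
have [e eP] := patP t; exists e => i.
have et : codes e t by split=> // u; rewrite eP.
have ere : codes e (r e) by apply: (rP e).2 et.
by apply/eqP; rewrite eq_le !(same e).
Qed.

(** * Windows of generalised polynomials *)

(** The order of the quantifiers is what matters: the index type J of the terms
    and the exponent k are chosen before N, whereas the finite type K of codes
    depends on N and the coefficients c on the starting point x. *)
Definition few_windows (R : realType) (f : R -> R) : Prop :=
  exists (J : finType) (k : nat), forall N : nat,
    exists (K : finType) (w : K -> J -> 'I_N -> int),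
      [/\ (#|K| <= N.+2 ^ k)%N,
          forall q j i, (`|w q j i| <= N.+2 ^ k)%N &
          forall x : R, exists q (c : J -> R), forall i : 'I_N,
            f (x + i%:R) = \sum_j c j * (w q j i)%:~R].

(** The coefficients are those of the Taylor expansion of p at x. *)
Lemma few_windows_poly (R : realType) (p : {poly R}) :
  few_windows (fun x => p.[x]).
Proof.
exists 'I_(size p), (size p) => N.
exists unit, (fun _ (j : 'I_(size p)) (i : 'I_N) => i%:Z ^+ j).
split=> [|_ j i|x]; first by rewrite card_unit expn_gt0.
  rewrite abszX absz_nat leq_exp_bound//; last exact: ltnW (ltn_ord j).
  by rewrite (leq_trans (ltnW (ltn_ord i)))// leqW// leqW.
exists tt, (fun j : 'I_(size p) => (p \Po ('X + x%:P))`_j) => i.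
have size_q : (size (p \Po ('X + x%:P)) <= size p)%N.
  by rewrite size_comp_poly2// size_XaddC.
transitivity ((p \Po ('X + x%:P)).[i%:R]).
  by rewrite horner_comp !hornerE addrC.
rewrite (horner_coef_wide _ size_q); apply: eq_bigr => j _.
by rewrite rmorphXn.
Qed.

Lemma few_windows_add (R : realType) (f g : R -> R) :
  few_windows f -> few_windows g -> few_windows (fun x => f x + g x).
Proof.
move=> [J [k fP]] [J' [k' gP]]; exists (J + J')%type, (k + k')%N => N.
have [K [w [cardK w_le fE]]] := fP N.
have [K' [w' [cardK' w'_le gE]]] := gP N.
exists (K * K')%type, (fun q s => match s with
  inl j => w q.1 j | inr j => w' q.2 j end); split=> [|q [j|j] i|x].
- by rewrite card_prod expnD leq_mul.
- by rewrite (leq_trans (w_le _ _ _))// leq_exp_bound// leq_addr.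
- by rewrite (leq_trans (w'_le _ _ _))// leq_exp_bound// leq_addl.
have [q [c fxE]] := fE x; have [q' [c' gxE]] := gE x.
exists (q, q'), (fun s => match s with inl j => c j | inr j => c' j end) => i.
by rewrite big_sumType/= fxE gxE.
Qed.

Lemma few_windows_mul (R : realType) (f g : R -> R) :
  few_windows f -> few_windows g -> few_windows (fun x => f x * g x).
Proof.
move=> [J [k fP]] [J' [k' gP]]; exists (J * J')%type, (k + k')%N => N.
have [K [w [cardK w_le fE]]] := fP N.
have [K' [w' [cardK' w'_le gE]]] := gP N.
exists (K * K')%type, (fun q s i => w q.1 s.1 i * w' q.2 s.2 i).
split=> [|q s i|x].
- by rewrite card_prod expnD leq_mul.
- by rewrite abszM expnD leq_mul.
have [q [c fxE]] := fE x; have [q' [c' gxE]] := gE x.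
exists (q, q'), (fun s => c s.1 * c' s.2) => i.
rewrite fxE gxE mulr_suml.
rewrite -(pair_big predT predT (fun j j' => c j * c' j' *
  (w q j i * w' q' j' i)%:~R))/=.
apply: eq_bigr => j _; rewrite mulr_sumr; apply: eq_bigr => j' _.
by rewrite intrM mulrACA.
Qed.

Lemma floor_split (R : realType) (J : finType) (c : J -> R) (w : J -> int) :
  Num.floor (\sum_j c j * (w j)%:~R) = \sum_j Num.floor (c j) * w j +
    Num.floor (\sum_j (c j - (Num.floor (c j))%:~R) * (w j)%:~R).
Proof.
rewrite addrC; set z := (X in _ = _ + X).
have -> : \sum_j c j * (w j)%:~R =
    \sum_j (c j - (Num.floor (c j))%:~R) * (w j)%:~R + z%:~R :> R.
  rewrite rmorph_sum -big_split; apply: eq_bigr => j _ /=.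
  by rewrite intrM -mulrDl subrK.
by rewrite floorDrz ?intr_int// intrKfloor.
Qed.

(** The old functions w_j are kept, now with integer coefficients, and the floor
    of the sum with fractional coefficients is added as one more function,
    indexed by the unit summand of J + unit. *)
Lemma few_windows_floor (R : realType) (f : R -> R) :
  few_windows f -> few_windows (fun x => (Num.floor (f x))%:~R).
Proof.
move=> [J [k fP]].
exists (J + unit)%type, (k + (#|J| + k + 4) * #|J|.+1)%N => N.
have [K [w [cardK w_le fE]]] := fP N.
set b := ((N * (2 * (#|J| * N.+2 ^ k)).+1).+1)%N.
have J_le : (#|J| <= N.+2 ^ #|J|)%N.
  by rewrite ltnW// (leq_trans (ltn_expl #|J| (ltnSn 1)))// leq_exp_bound.
have b_le : (b <= N.+2 ^ (#|J| + k + 4))%N.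
  have q4 : (3 * N + 1 <= N.+2 ^ 4)%N.
    by rewrite (@leq_trans (N.+2 ^ 2))// ?leq_pexp2l//; nia.
  rewrite expnD mulnC (leq_trans _ (leq_mul q4 (leqnn _)))// /b.
  have : (#|J| * N.+2 ^ k <= N.+2 ^ (#|J| + k))%N by rewrite expnD leq_mul.
  have : (0 < N.+2 ^ (#|J| + k))%N by rewrite expn_gt0.
  nia.
have /choice[F FP] := fun q => @floor_patterns R J N _ (w q) (w_le q).
exists (K * 'I_(b ^ #|J|.+1))%type, (fun qe j i =>
  if j is inl j then w qe.1 j i else F qe.1 qe.2 i).
split=> [|[q e] [j|[]] i|x] /=.
- rewrite card_prod card_ord expnD leq_mul// expnM leq_exp_bound//.
  by rewrite expn_gt0.
- by rewrite (leq_trans (w_le _ _ _))// leq_exp_bound// leq_addr.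
- rewrite (leq_trans ((FP q).1 e i))//.
  apply: leq_trans (leq_mul J_le (leqnn _)) _.
  rewrite -expnD leq_exp_bound// (leq_trans _ (leq_addl _ _))//.
  by rewrite (leq_trans _ (leq_pmulr _ _))// leq_addr.
have [q [c fxE]] := fE x.
have t01 j : 0 <= c j - (Num.floor (c j))%:~R <= 1.
  have := floor_le (c j); have := floorD1_gt (c j); rewrite intrD; lra.
have [e eP] := (FP q).2 _ t01.
exists (q, e), (fun j => if j is inl j then (Num.floor (c j))%:~R else 1) => i.
rewrite big_sumType/= sumr_const card_unit mulr1n mul1r.
rewrite fxE floor_split -eP intrD rmorph_sum.
congr (_ + _); apply: eq_bigr => j _; exact: intrM.
Qed.

Lemma GP_few_windows (R : realType) (f : R -> R) :
  GP_real f -> few_windows f.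
Proof.
elim=> [p|g h _ gP _ hP|g h _ gP _ hP|g _ gP].
- exact: few_windows_poly.
- exact: few_windows_add.
- exact: few_windows_mul.
- exact: few_windows_floor.
Qed.

(** * Counting subwords *)

Lemma subword_complexity_le (Sigma : finType) (a : nat -> Sigma) (N : nat)
    (T : finType) (code : T -> nat -> Prop) :
  (forall n, exists q, code q n) ->
  (forall q m n, code q m -> code q n -> subword a m N = subword a n N) ->
  (subword_complexity a N <= #|T|)%N.
Proof.
move=> coded same.
have rep q : exists m, forall n, code q n -> code q m.
  case: (pselect (exists n, code q n)) => [[m qm]|no_n]; first by exists m.
  by exists 0%N => n qn; case: no_n; exists n.
have [r rP] := choice rep.
apply: leq_trans (leq_imset_card (fun q => subword a (r q) N) T).
apply/subset_leq_card/fintype.subsetP => u; rewrite inE => /asboolP[n ->].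
have [q qn] := coded n; apply/imsetP; exists q => //.
exact: same qn (rP _ _ qn).
Qed.

Lemma bracket_word_complexity (R : realType) (Sigma : finType)
    (a : nat -> Sigma) :
  bracket_word R a ->
  exists k r d, forall N,
    (subword_complexity a N <= N.+2 ^ k * (N * r).+1 ^ d)%N.
Proof.
move=> [g [[G /GP_few_windows[J [k GP]] gE] /finite_seqP[s gs] [c aE]]].
exists k, (size s), #|J|.+1 => N.
have [K [w [cardK _ wP]]] := GP N.
pose I := ('I_N * 'I_(size s))%type.
have cardI : #|{: I}| = (N * size s)%N by rewrite card_prod !card_ord.
have /choice[pat patP] := fun q => @threshold_patterns R I J
  (fun u j => (w q j u.1)%:~R) (fun u => s`_(u.2)).
rewrite cardI in pat patP.
pose T := (K * 'I_((N * size s).+1 ^ #|J|.+1))%type.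
pose code (q : T) n :=
  forall u : I, pat q.1 q.2 u = (s`_(u.2) <= g (n + u.1)%N).
apply: (@leq_trans #|{: T}|); last by rewrite card_prod card_ord leq_mul.
apply: (@subword_complexity_le _ _ _ _ code) => [n|q m n qm qn].
  have [q [d dE]] := wP n%:R; have [e eP] := patP q d.
  by exists (q, e) => u; rewrite eP gE natrD dE.
(* g (m' + i) is itself one of the thresholds, and it lies below g (m' + i),
   hence below g (n' + i) since the patterns agree. *)
have le_g m' n' (i : 'I_N) : code q m' -> code q n' ->
    g (m' + i)%N <= g (n' + i)%N.
  move=> qm' qn'.
  have g_s : g (m' + i)%N \in s.
    by have : [set` s]%classic (g (m' + i)%N) by rewrite -gs; exists (m' + i)%N.
  have lt_u : (index (g (m' + i)%N) s < size s)%N by rewrite index_mem.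
  have := qn' (i, Ordinal lt_u); rewrite qm' /= nth_index// => <-.
  exact: lexx.
apply: eq_from_tnth => i; rewrite !tnth_mktuple !aE; congr (c _).
by apply/eqP; rewrite eq_le !le_g.
Qed.

Theorem theoremA (R : realType) (Sigma : finType) (a : nat -> Sigma)
    (ha : bracket_word R a) :
  exists2 C : R, 0 < C &
    exists2 K : R, 0 < K &
      forall N : nat, (0 < N)%N ->
        (subword_complexity a N)%:R <= K * N%:R `^ C.
Proof.
have [k [r [d complexity_le]]] := bracket_word_complexity ha.
(* The successor makes the exponent positive even when k = d = 0. *)
exists (k + d).+1%:R; first by rewrite ltr0n.
exists (3 ^ k * r.+1 ^ d)%:R; first by rewrite ltr0n muln_gt0 !expn_gt0.
(* For N > 0, N + 2 <= 3 N and N r + 1 <= (r + 1) N. *)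
move=> N N_gt0; rewrite powR_mulrn// -natrX -natrM ler_nat.
apply: leq_trans (complexity_le N) _.
apply: (@leq_trans ((3 * N) ^ k * (r.+1 * N) ^ d)).
  by rewrite leq_mul// leq_exp_bound//; nia.
rewrite !expnMn mulnACA leq_mul2l -expnD leq_exp_bound ?orbT//.
Qed.
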